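(* Let $K$ be a field of characteristic different from $2$, and let $\varphi$ be an anisotropic quadratic form over $K$ of dimension $n$ which represents $1$. Let $X=(X_1,\ldots,X_n)$ be algebraically independent variables and let $f\in K[X]$ be an irreducible polynomial in which every variable $X_i$ appears. Suppose that $f$ is unitary for the lexicographical order (its leading coefficient with respect to the lexicographical ordering of monomials is $1$), and let $M$ be the (total) degree of the leading term of $f$ for the lexicographical order. Then the following are equivalent: (1) $f\in D_{K(X)}(\varphi)^m$ for some $m\leq M$; (2) $\varphi_{K(f)}$ is isotropic.
   Context: Quadratic forms are finite-dimensional and nondegenerate. For a field extension $F/K$, $D_F(\varphi)$ denotes the set of nonzero elements of $F$ represented by $\varphi$ over $F$, and $D_F(\varphi)^m=\{a_1\cdots a_m : a_i\in D_F(\varphi)\}$ is the set of products of $m$ elements of $D_F(\varphi)$. For an irreducible polynomial $g\in K[X_1,\ldots,X_n]$, $K(g)$ denotes the field of fractions of the integral domain $K[X_1,\ldots,X_n]/(g)$. A form is isotropic if it represents $0$ nontrivially. *)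

(* Defs.v *)
From HB Require Import structures.
From mathcomp Require Import all_boot all_order all_algebra.
From mathcomp Require Import generic_quotient ring_quotient fraction.
From mathcomp Require Import boolp.
From mathcomp Require Import mpoly.

Set Implicit Arguments.
Unset Strict Implicit.
Unset Printing Implicit Defensive.

Import Order.TTheory GRing.Theory.

Local Open Scope ring_scope.
Local Open Scope quotient_scope.

Definition irreducible_elt (R : idomainType) (a : R) : Prop :=
  a \isn't a GRing.unit /\
  forall b c : R, a = b * c -> b \is a GRing.unit \/ c \is a GRing.unit.

Definition dvdr (R : idomainType) (a b : R) : Prop := exists q, b = q * a.

Definition prime_elt (R : idomainType) (p : R) : Prop :=
  [/\ p != 0, p \isn't a GRing.unit &
      forall a b, dvdr p (a * b) -> dvdr p a \/ dvdr p b].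

(* Up to [ufd_mpoly], this is the proof that K[X_1, .., X_n] is factorial; it is
   needed only to know that an irreducible f generates a prime ideal.
   [pfact k a]: a is a unit times a product of k primes. *)
Inductive pfact (R : idomainType) : nat -> R -> Prop :=
| pfact_unit u : u \is a GRing.unit -> pfact 0 u
| pfact_mul k p a : prime_elt p -> pfact k a -> pfact k.+1 (p * a).

Definition is_ufd (R : idomainType) : Prop :=
  forall a : R, a != 0 -> exists k, pfact k a.

Section Factorial.
Variable R : idomainType.
Implicit Types a b c p q u : R.

Lemma dvdr_mull p a b : dvdr p a -> dvdr p (b * a).
Proof. by move=> [q ->]; exists (b * q); rewrite mulrA. Qed.

Lemma dvdr_trans a b c : dvdr a b -> dvdr b c -> dvdr a c.
Proof. by move=> ab [q ->]; apply: dvdr_mull. Qed.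

Lemma dvdr_unit p u : u \is a GRing.unit -> dvdr p u -> p \is a GRing.unit.
Proof. by move=> + [q eu]; rewrite eu unitrM => /andP[]. Qed.

Lemma prime_unitM p u : prime_elt p -> u \is a GRing.unit -> prime_elt (p * u).
Proof.
move=> [p0 pU pP] uU; have up a : dvdr p a -> dvdr (p * u) a.
  by move=> [q ->]; exists (q / u); rewrite [p * u]mulrC mulrA divrK.
split.
- by rewrite mulf_neq0 //; apply: contraTneq uU => ->; rewrite unitr0.
- by rewrite unitrM (negbTE pU).
move=> a b [q e]; have /pP[] : dvdr p (a * b).
  by exists (q * u); rewrite e mulrAC mulrA.
  by left; apply: up.
by right; apply: up.
Qed.

Lemma pfactMu k a u : u \is a GRing.unit -> pfact k a -> pfact k (u * a).
Proof.
move=> uU; elim=> {k a} [v vU|k p a pp _ IH].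
  by apply: pfact_unit; rewrite unitrM uU.
by rewrite mulrCA; apply: pfact_mul.
Qed.

Lemma pfactM k l a b : pfact k a -> pfact l b -> pfact (k + l) (a * b).
Proof.
move=> ka lb; elim: ka => {k a} [v vU|k p a pp _ IH]; first exact: pfactMu.
by rewrite -mulrA; apply: pfact_mul.
Qed.

Lemma pfact_dvd k c p : pfact k c -> prime_elt p -> dvdr p c ->
  exists k' c', [/\ k = k'.+1, c = p * c' & pfact k' c'].
Proof.
move=> kc [p0 pU pP]; elim: kc => {k c} [u uU /(dvdr_unit uU)|k q c qp kc IH].
  by rewrite (negbTE pU).
case/pP => [[t qt]|/IH [k' [c' [-> -> kc']]]]; last first.
  by exists k'.+1, (q * c'); split=> //; [rewrite mulrCA|apply: pfact_mul].
exists k, (t * c); rewrite {1}qt -mulrA mulrCA; split=> //.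
apply: pfactMu => //; case: qp => q0 qU qP.
have t0 : t != 0 by apply: contraNneq q0 => t0; rewrite qt t0 mul0r.
have /qP[[s ts]|[s ps]] : dvdr q (t * p) by exists 1; rewrite mul1r.
  case/negP: pU; apply/unitrP; exists s.
  suff sp : s * p = 1 by rewrite [p * s]mulrC sp.
  by apply: (mulfI t0); rewrite mulr1 mulrCA {2}ts qt mulrA.
apply/unitrP; exists s; suff st : s * t = 1 by rewrite [t * s]mulrC st.
by apply: (mulIf p0); rewrite mul1r -mulrA -qt.
Qed.

Lemma irreducible_prime a : is_ufd R -> irreducible_elt a -> prime_elt a.
Proof.
move=> fR [aU aI]; have /fR[k ka] : a != 0.
  apply: contraNneq aU => a0.
  by have [] := aI 0 0; rewrite ?mulr0 // a0.
case: ka aU aI => {k a} [u ->//|k p a pp ka aU /(_ p a erefl)[]].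
  by case: pp => _ /negbTE->.
exact: prime_unitM.
Qed.

End Factorial.

Section FactorialPoly.
Variable R : idomainType.
Hypothesis fR : is_ufd R.
Implicit Types (c d : R) (p q a b : {poly R}).

Lemma dvdrC c p : dvdr c%:P p <-> forall i, dvdr c p`_i.
Proof.
split=> [[q ->] i|]; first by exists q`_i; rewrite coefMC.
elim/poly_ind: p => [_|p d IH cp]; first by exists 0; rewrite mul0r.
have [i|q qp] := IH.
  by have := cp i.+1; rewrite coefD coefMX coefC addr0.
have := cp 0; rewrite coefD coefMX coefC add0r => -[e ->].
exists (q * 'X + e%:P); rewrite mulrDl qp polyCM; congr (_ + _).
by rewrite mulrAC.
Qed.

Lemma prime_polyC c : prime_elt c -> prime_elt c%:P.
Proof.
move=> [c0 cU cP]; split; first by rewrite polyC_eq0.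
  by rewrite poly_unitE size_polyC c0 coefC.
have dvdMXD p (d : R) : dvdr c d -> dvdr c%:P p -> dvdr c%:P (p * 'X + d%:P).
  move=> cd /dvdrC cp; apply/dvdrC => -[|i]; rewrite coefD coefMX coefC.
    by rewrite add0r.
  by rewrite addr0.
have dvdX p : dvdr c%:P (p * 'X) -> dvdr c%:P p.
  by move=> /dvdrC cp; apply/dvdrC => i; have := cp i.+1; rewrite coefMX.
have dvdB p q : dvdr c%:P (p + q) -> dvdr c%:P q -> dvdr c%:P p.
  by move=> [s e] [t f]; exists (s - t); rewrite mulrBl -e -f addrK.
have dvdCP d : dvdr c d -> dvdr c%:P d%:P.
  by move=> [e ->]; exists e%:P; rewrite polyCM.
move=> a; elim/poly_ind: a => [b _|a ca IHa b].
  by left; exists 0; rewrite mul0r.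
elim/poly_ind: b => [_|b cb IHb cab]; first by right; exists 0; rewrite mul0r.
have /cP[cca|ccb] : dvdr c (ca * cb).
  have /dvdrC/(_ 0) := cab.
  by rewrite coef0M !coefD !coefMX !coefC !add0r.
- have /IHa[] : dvdr c%:P (a * (b * 'X + cb%:P)); last 2 first.
  + by left; apply: dvdMXD.
  + by right.
  apply: dvdX; rewrite mulrAC; move: cab; rewrite mulrDl => /dvdB; apply.
  by rewrite mulrC; apply/dvdr_mull/dvdCP.
- have /IHb[] : dvdr c%:P ((a * 'X + ca%:P) * b); last 2 first.
  + by left.
  + by right; apply: dvdMXD.
  apply: dvdX; rewrite -mulrA; move: cab; rewrite mulrDr => /dvdB; apply.
  exact/dvdr_mull/dvdCP.
Qed.

Definition primitive p := forall c : R, prime_elt c -> ~ dvdr c%:P p.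

Lemma primitive_cancel k c p q a : pfact k c -> primitive p ->
  c%:P * a = q * p -> dvdr p a.
Proof.
move=> kc pp; elim: kc q => {k c} [u uU|k d c dp _ IH] q e.
  exists (u^-1%:P * q); rewrite -mulrA -e mulrA -polyCM mulVr //.
  by rewrite mul1r.
case: (prime_polyC dp) => d0 _ /(_ q p)[].
- by exists (c%:P * a); rewrite -e polyCM -mulrA mulrC.
- move=> [t qt]; apply: (IH t); apply: (mulfI d0).
  by rewrite mulrA -polyCM e qt mulrAC mulrC.
- by move/pp.
Qed.

Lemma primitive_split k c p a b : pfact k c -> c%:P * p = a * b ->
  exists a' b', [/\ p = a' * b', size a' = size a & size b' = size b].
Proof.
move=> kc; elim: kc a b => {k c} [u uU|k d c dp _ IH] a b e.
  exists (u^-1%:P * a), b; split=> //.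
    by rewrite -mulrA -e mulrA -polyCM mulVr ?mul1r.
  rewrite mul_polyC size_scale //.
  by apply: contraTneq uU => u0; rewrite -unitrV u0 unitr0.
case: (dp) => d0' _ _; case: (prime_polyC dp) => d0 _ /(_ a b)[].
- by exists (c%:P * p); rewrite -e polyCM -mulrA mulrC.
- move=> [t at_]; have [|a' [b' [pe sa sb]]] := IH t b.
    by apply: (mulfI d0); rewrite mulrA -polyCM e at_ mulrAC mulrC.
  by exists a', b'; rewrite at_ [t * _]mulrC mul_polyC size_scale.
- move=> [t bt_]; have [|a' [b' [pe sa sb]]] := IH a t.
    by apply: (mulfI d0); rewrite mulrA -polyCM e bt_ mulrA mulrC.
  by exists a', b'; rewrite bt_ [t * _]mulrC mul_polyC size_scale.
Qed.

Lemma primitive_prime p : primitive p -> irreducible_poly p -> prime_elt p.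
Proof.
move=> pp [p1 pI]; have p0 : p != 0 by rewrite -size_poly_gt0 ltnW.
have pdvd a : p %| a -> dvdr p a.
  case/Pdiv.WeakIdomain.dvdpP => -[c q] /= /fR[k kc].
  by rewrite -mul_polyC => /(primitive_cancel kc pp).
split=> //; first by rewrite poly_unitE gtn_eqF.
move=> a b [q e]; have {e} : p %| a * b.
  by rewrite e; apply/Pdiv.Idomain.dvdp_mull.
have [cpa|ncpa] := boolP (coprimep p a).
  by rewrite Gauss_dvdpr // => /pdvd; right.
have /pI/(_ (dvdp_gcdl p a)) := ncpa; rewrite /eqp => /andP[_ pg] _.
by left; apply/pdvd/(dvdp_trans pg)/dvdp_gcdr.
Qed.

Lemma pfact_polyC k c : pfact k c -> pfact k c%:P.
Proof.
elim=> {k c} [u uU|k d c dp _ IH].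
  apply: pfact_unit; rewrite poly_unitE coefC size_polyC uU andbT.
  by have [u0|//] := eqVneq u 0; rewrite u0 unitr0 in uU.
by rewrite polyCM; apply: pfact_mul => //; apply: prime_polyC.
Qed.

Lemma content k c p : pfact k c -> dvdr (lead_coef p) c ->
  exists l d p', [/\ pfact l d, p = d%:P * p' & primitive p'].
Proof.
elim: k c p => [|k IH] c p kc pc.
all: have [pp|] := pselect (primitive p);
    [by exists 0, 1, p; rewrite mul1r; split=> //; apply/pfact_unit/unitr1|].
all: move=> /existsNP[d /not_implyP[dp /contrapT[q pq]]].
all: have /(pfact_dvd kc dp) [k' [c' [ek ec kc']]] : dvdr d c.
1,3: by apply: dvdr_trans pc; exists (lead_coef q); rewrite pq lead_coefM lead_coefC.
  by [].
case: ek => ek; rewrite -ek in kc'.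
have [|l [e [p' [le qe pp']]]] := IH c' q kc'.
  case: (dp) => d0 _ _; case: pc => t; rewrite pq ec lead_coefM lead_coefC mulrA mulrC.
  by move/(mulIf d0) => ->; exists t.
exists l.+1, (d * e), p'; split=> //; first exact: pfact_mul.
by rewrite pq qe mulrC polyCM mulrA.
Qed.

Lemma ufd_poly : is_ufd {poly R}.
Proof.
move=> p; have [m] := ubnP (size p); elim: m p => // m IH p; rewrite ltnS => pm p0.
have /fR[k kc] : lead_coef p != 0 by rewrite lead_coef_eq0.
have [|l [d [p' [ld pp' p'p]]]] := @content _ _ p kc; first by exists 1; rewrite mul1r.
have p'0 : p' != 0 by apply: contraNneq p0 => p'0; rewrite pp' p'0 mulr0.
have d0 : d != 0 by apply: contraNneq p0 => d0; rewrite pp' d0 mul0r.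
have sp' : size p' = size p by rewrite pp' mul_polyC size_scale.
suff [k' kp'] : exists k', pfact k' p'.
  by exists (l + k')%N; rewrite pp'; apply/pfactM/kp'/pfact_polyC.
have [p1|p1] := leqP (size p') 1.
  have e := size1_polyC p1; have /fR[k' kk'] : p'`_0 != 0.
    by apply: contraNneq p'0; rewrite {2}e => ->.
  by exists k'; rewrite e; apply: pfact_polyC.
have [pI|] := pselect (irreducible_poly p').
  exists 1; rewrite -[p']mulr1; apply: pfact_mul; first exact: primitive_prime.
  exact/pfact_unit/unitr1.
move=> /not_andP[//|/existsNP[q /not_implyP[q1 /not_implyP[qp' nqp']]]].
have [[c r] /= c0] := Pdiv.WeakIdomain.dvdpP _ _ qp'.
rewrite -mul_polyC => e; have [kc' kc'c] := fR c0.
have [a [b [pab sa sb]]] := primitive_split kc'c e.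
have := p'0; rewrite pab mulf_eq0 negb_or => /andP[a0 b0].
have r0 : r != 0 by rewrite -size_poly_gt0 -sa size_poly_gt0.
have q0 : q != 0 by rewrite -size_poly_gt0 -sb size_poly_gt0.
have sp : size p' = (size r + size q).-1 by rewrite pab size_mul // sa sb.
have sq : (1 < size q)%N.
  by rewrite ltn_neqAle eq_sym q1 size_poly_gt0.
have sr : (1 < size r)%N.
  rewrite ltn_neqAle size_poly_gt0 r0 andbT; apply/eqP => r1; apply: nqp'.
  by rewrite -dvdp_size_eqp // sp -r1 add1n.
have [ka kaP] : exists k, pfact k a.
  apply: IH => //; rewrite sa; apply: leq_trans pm; rewrite -sp' sp.
  by rewrite -ltnS prednK ?addn_gt0 ?size_poly_gt0 ?r0 // -addn1 ltn_add2l.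
have [kb kbP] : exists k, pfact k b.
  apply: IH => //; rewrite sb; apply: leq_trans pm; rewrite -sp' sp.
  by rewrite -ltnS prednK ?addn_gt0 ?size_poly_gt0 ?r0 // -[(size q).+1]add1n ltn_add2r.
by exists (ka + kb)%N; apply: pfactM.
Qed.

End FactorialPoly.

Section FactorialIso.
Variables (R S : idomainType) (g : {rmorphism R -> S}) (h : {rmorphism S -> R}).
Hypotheses (gK : cancel g h) (hK : cancel h g).

Lemma prime_iso p : prime_elt p -> prime_elt (h p).
Proof.
have hd a b : dvdr (h a) (h b) <-> dvdr a b.
  split=> [[q e]|[q ->]]; last by exists (h q); rewrite rmorphM.
  by exists (g q); apply: (can_inj hK); rewrite e rmorphM gK.
move=> [p0 pU pP]; split.
- by rewrite -(rmorph0 h) (can_eq hK).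
- apply: contra pU => hpU; rewrite -[p]hK; exact: rmorph_unit.
by move=> a b; rewrite -[a]gK -[b]gK -rmorphM !hd; apply: pP.
Qed.

Lemma ufd_iso : is_ufd S -> is_ufd R.
Proof.
move=> uS a a0; have /uS[k] : g a != 0 by rewrite -(rmorph0 g) (can_eq gK).
rewrite -{2}[a]gK => kga; exists k; elim: kga => {a0 k} [u uU|k p b pp _ IH].
  exact/pfact_unit/rmorph_unit.
by rewrite rmorphM; apply: pfact_mul => //; apply: prime_iso.
Qed.

End FactorialIso.

Section FactorialMpoly.
Variable K : fieldType.

Lemma mpoly_rmorph_eq n (S : nzRingType) (g h : {rmorphism {mpoly K[n]} -> S}) :
  (forall c, g c%:MP = h c%:MP) -> (forall i, g 'X_i = h 'X_i) -> g =1 h.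
Proof.
move=> gC gX p; rewrite (mpolyE p) !rmorph_sum; apply: eq_bigr => m _.
rewrite -mul_mpolyC !rmorphM gC mpolyXE_id !rmorph_prod; congr (_ * _).
by apply: eq_bigr => i _; rewrite !rmorphXn gX.
Qed.

Section Step.
Variable n : nat.
Notation A := {mpoly K[n]}.
Notation widen := (widen_ord (leqnSn n)).

Definition mmulX (p : {poly A}) : {mpoly K[n.+1]} :=
  (map_poly (@mwiden n K) p).['X_ord_max].

HB.instance Definition _ := GRing.RMorphism.copy mmulX
  (horner_eval 'X_ord_max \o map_poly (@mwiden n K)).

Lemma muniX_max : muni ('X_ord_max : {mpoly K[n.+1]}) = 'X.
Proof.
rewrite muniE msuppX big_seq1 mcoeffX eqxx scale1r mnm1E eqxx expr1.
suff -> : [multinom (U_(ord_max)%MM : 'X_{1..n.+1}) (widen i) | i < n] = 0%MM.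
  by rewrite mpolyX0 scale1r.
by apply/mnmP => i; rewrite mnmE mnm1E mnm0E -val_eqE /= gtn_eqF.
Qed.

Lemma muniX_widen (i : 'I_n) : muni ('X_(widen i) : {mpoly K[n.+1]}) = ('X_i)%:P.
Proof.
rewrite muniE msuppX big_seq1 mcoeffX eqxx scale1r mnm1E.
rewrite -val_eqE /= ltn_eqF // expr0.
suff -> : [multinom (U_(widen i)%MM : 'X_{1..n.+1}) (widen j) | j < n] = U_(i)%MM.
  by rewrite -mul_polyC mulr1.
by apply/mnmP => j; rewrite mnmE !mnm1E -!val_eqE.
Qed.

Lemma mmulXC (a : A) : mmulX a%:P = mwiden a.
Proof. by rewrite /mmulX map_polyC hornerC. Qed.

Lemma mmulXX : mmulX 'X = 'X_ord_max.
Proof. by rewrite /mmulX map_polyX hornerX. Qed.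

Lemma mwidenX1 (i : 'I_n) : mwiden ('X_i : A) = 'X_(widen i).
Proof. by rewrite mwidenX mnmwiden1. Qed.

Lemma muniK : cancel (@muni n K) mmulX.
Proof.
apply: (@mpoly_rmorph_eq _ _ (mmulX \o @muni n K) idfun) => /= [c|i].
  by rewrite muniC mmulXC mwidenC.
have [[j ->]|->] : (exists j, i = widen j) \/ i = ord_max.
- have [lti|gei] := ltnP i n.
    by left; exists (Ordinal lti); apply: val_inj.
  by right; apply/val_inj/eqP; rewrite eqn_leq gei -ltnS ltn_ord.
- by rewrite muniX_widen mmulXC mwidenX1.
- by rewrite muniX_max mmulXX.
Qed.

Lemma mmulXK : cancel mmulX (@muni n K).
Proof.
have wK : (@muni n K) \o (@mwiden n K) =1 polyC.
  apply: mpoly_rmorph_eq => /= [c|i]; first by rewrite mwidenC muniC.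
  by rewrite mwidenX1 muniX_widen.
elim/poly_ind => [|p c IH]; first by rewrite !rmorph0.
by rewrite !rmorphD !rmorphM /= IH mmulXX muniX_max mmulXC; congr (_ + _); apply: wK.
Qed.

End Step.

Lemma ufd_mpoly n : is_ufd {mpoly K[n]}.
Proof.
elim: n => [|n IH]; last exact: ufd_iso (@muniK n) (@mmulXK n) (ufd_poly IH).
move=> p p0; exists 0; apply: pfact_unit.
have e : p = (p@_0)%:MP.
  apply/mpolyP => m; have -> : m = 0%MM by apply/mnmP => -[].
  by rewrite mcoeffC eqxx mulr1.
rewrite e rmorph_unit // unitfE; apply: contraNneq p0 => pc0.
by rewrite e pc0.
Qed.

End FactorialMpoly.

Section FunctionField.
Variables (K : fieldType) (n : nat) (f : {mpoly K[n]}).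

(* The ideal (f) of K[X_1, .., X_n]; the irreducibility proof is a parameter so
   that the primality of (f) can be recorded as a canonical instance. *)
Definition principal_ideal (_ : irreducible_elt f) : {pred {mpoly K[n]}} :=
  fun p => `[< exists q, p = q * f >].

Variable f_irr : irreducible_elt f.

Lemma principal_idealP p :
  reflect (dvdr f p) (p \in principal_ideal f_irr).
Proof. exact: asboolP. Qed.

Lemma principal_ideal_closed : idealr_closed (principal_ideal f_irr).
Proof.
split.
- by apply/principal_idealP; exists 0; rewrite mul0r.
- apply/principal_idealP => -[q e]; case: f_irr => /negP[].
  by apply/unitrP; exists q; rewrite [f * q]mulrC -e.
move=> a u v /principal_idealP[q ->] /principal_idealP[r ->].
by apply/principal_idealP; exists (a * q + r); rewrite mulrDl mulrA.
Qed.

HB.instance Definition _ := isIdealr.Build _ (principal_ideal f_irr)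
  principal_ideal_closed.

Lemma principal_ideal_prime : prime_idealr_closed (principal_ideal f_irr).
Proof.
move=> u v /principal_idealP.
have [_ _ fP] := irreducible_prime (@ufd_mpoly K n) f_irr.
by case/fP => fu; apply/orP; [left|right]; apply/principal_idealP.
Qed.

HB.instance Definition _ := isPrimeIdealrClosed.Build _ (principal_ideal f_irr)
  principal_ideal_prime.

Definition coord_ring : Type := {ideal_quot (principal_ideal f_irr)}.

HB.instance Definition _ := GRing.ComNzRing.on coord_ring.

Definition coord_unit : pred coord_ring := fun x => `[< exists y, y * x = 1 >].

Definition coord_inv (x : coord_ring) : coord_ring :=
  if pselect (exists y, y * x = 1) is left ex then projT1 (cid ex) else x.

Lemma coord_mulVr : {in coord_unit, left_inverse 1 coord_inv *%R}.
Proof.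
move=> x /asboolP xU; rewrite /coord_inv; case: pselect => // ex.
exact: projT2 (cid ex).
Qed.

Lemma coord_unitP x y : y * x = 1 -> coord_unit x.
Proof. by move=> yx; apply/asboolP; exists y. Qed.

Lemma coord_inv_out : {in [predC coord_unit], coord_inv =1 id}.
Proof.
by move=> x /asboolP xU; rewrite /coord_inv; case: pselect.
Qed.

HB.instance Definition _ := GRing.ComNzRing_hasMulInverse.Build coord_ring
  coord_mulVr coord_unitP coord_inv_out.

HB.instance Definition _ := GRing.ComUnitRing_isIntegral.Build coord_ring
  (@Quotient.rquot_IdomainAxiom _ (principal_ideal f_irr)).

Definition coord_pi (p : {mpoly K[n]}) : coord_ring :=
  \pi_({ideal_quot (principal_ideal f_irr)}) p.

HB.instance Definition _ := GRing.RMorphism.copy coord_pi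
  (\pi_({ideal_quot (principal_ideal f_irr)})).

Definition function_field : fieldType := {fraction coord_ring}.

Definition function_field_const : {rmorphism K -> function_field} :=
  (@tofrac coord_ring \o coord_pi \o @mpolyC n K).

End FunctionField.

Definition rational_functions (K : fieldType) (n : nat) : fieldType :=
  {fraction {mpoly K[n]}}.

Definition rational_functions_const (K : fieldType) (n : nat) :
    {rmorphism K -> rational_functions K n} :=
  @tofrac {mpoly K[n]} \o @mpolyC n K.

(* A nondegenerate quadratic form of dimension n in characteristic different
   from 2, given in coordinates by its Gram matrix. *)
Record quadform (K : fieldType) (n : nat) := QuadForm {
  gram : 'M[K]_n;
  gram_sym : gram^T = gram;
  gram_nondegenerate : gram \in unitmx }.

Definition qeval (K : fieldType) (n : nat) (phi : quadform K n) (v : 'rV[K]_n) : K :=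
  (v *m gram phi *m v^T) 0 0.

Section BaseChange.
Variables (K F : fieldType) (n : nat) (iota : {rmorphism K -> F}).
Variable phi : quadform K n.

Lemma gram_base_sym : (map_mx iota (gram phi))^T = map_mx iota (gram phi).
Proof. by rewrite map_trmx gram_sym. Qed.

Lemma gram_base_nondegenerate : map_mx iota (gram phi) \in unitmx.
Proof. by rewrite map_unitmx gram_nondegenerate. Qed.

Definition base_change : quadform F n :=
  QuadForm gram_base_sym gram_base_nondegenerate.

End BaseChange.

Section Values.
Variables (K : fieldType) (n : nat) (phi : quadform K n).

Definition isotropic : Prop := exists2 v : 'rV[K]_n, v != 0 & qeval phi v = 0.

Definition anisotropic : Prop := ~ isotropic.

Definition values (a : K) : Prop := a != 0 /\ exists v, qeval phi v = a.

Definition value_products (m : nat) (a : K) : Prop :=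
  exists2 b : 'I_m -> K, forall i, values (b i) & a = \prod_(i < m) b i.

End Values.

(* Leading exponent for the lexicographic order with X_1 > .. > X_n; [mlead]
   uses the degree-lexicographic order instead. *)
Definition lexlead (K : fieldType) (n : nat) (p : {mpoly K[n]}) : 'X_{1..n} :=
  Multinom (\join_(m <- msupp p) (multinom_val m : n.-tuplelexi nat))%O.

Lemma lexlead_supp (K : fieldType) (n : nat) (p : {mpoly K[n]}) :
  p != 0 -> lexlead p \in msupp p.
Proof.
rewrite -msupp_eq0 /lexlead; elim: (msupp p) => // m [_ _|m' s IH _].
  by rewrite big_seq1 mem_seq1 -val_eqE.
rewrite big_cons in_cons joinEtotal maxElt; case: ifP => _.
  by rewrite IH ?orbT.
by rewrite -val_eqE eqxx.
Qed.

Lemma lexlead_max (K : fieldType) (n : nat) (p : {mpoly K[n]}) m :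
  m \in msupp p -> m != lexlead p ->
  exists2 i : 'I_n, forall j : 'I_n, (j < i)%N -> m j = lexlead p j &
                    (m i < lexlead p i)%N.
Proof.
move=> mp ne; suff : ((multinom_val m : n.-tuplelexi nat) <
    (multinom_val (lexlead p) : n.-tuplelexi nat))%O by move/ltxi_tuplePlt.
rewrite lt_neqAle; apply/andP; split; last exact: joins_sup_seq.
by apply: contraNneq ne => e; rewrite -val_eqE; apply/eqP.
Qed.

Definition all_variables_appear (K : fieldType) (n : nat) (p : {mpoly K[n]}) :=
  forall i : 'I_n, exists2 m, m \in msupp p & m i != 0%N.

(* Main.v *)
(** Work inside the factorial rings R, R[X], .. of iterated
    polynomials, with "isotropic over the function field of p" replaced by
    "p divides some value of the form at a vector that p does not divide".

    A product of values is, at every prime p, of even valuation unless the form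
    is isotropic modulo p; this gives (1) => (2). For the converse, consider a
    polynomial f over R all of whose primes of odd valuation are isotropic. If p
    is an isotropic prime of positive degree, reduce an isotropic vector modulo p
    and make it primitive: its value is p h with deg h <= deg p - 2. The primes
    dividing h are isotropic too, so by induction on the degree f times its
    leading coefficient c is a product of deg f values. By the first part, the
    odd primes of c are isotropic, hence by induction on the number of variables
    c is a product of as many values as the degree of its leading monomial. *)

Require Import Defs.
From HB Require Import structures.
From mathcomp Require Import all_boot all_order all_algebra.
From mathcomp Require Import perm generic_quotient ring_quotient.
From mathcomp Require Import fraction mpoly boolp ring zify.

Set Implicit Arguments.
Unset Strict Implicit.
Unset Printing Implicit Defensive.

Import GRing.Theory.

Local Open Scope ring_scope.

(** * Valuations at a prime element *)

Section Divisibility.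
Variable R : idomainType.
Implicit Types a b c p q g : R.

Lemma dvdr_mulr p a b : dvdr p a -> dvdr p (a * b).
Proof. by rewrite mulrC; apply: dvdr_mull. Qed.

Lemma dvdr_add p a b : dvdr p a -> dvdr p b -> dvdr p (a + b).
Proof. by move=> [x ->] [y ->]; exists (x + y); rewrite mulrDl. Qed.

Lemma dvdr_addr p a b : dvdr p a -> dvdr p (a + b) -> dvdr p b.
Proof. by move=> [x ->] [y e]; exists (y - x); rewrite mulrBl -e addrAC subrr add0r. Qed.

Lemma dvdr_primeM p a b : prime_elt p -> ~ dvdr p a -> dvdr p (a * b) -> dvdr p b.
Proof. by move=> [_ _ pP] na /pP[]. Qed.

Lemma dvdr_prime_sym p g : prime_elt p -> prime_elt g -> dvdr g p -> dvdr p g.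
Proof.
move=> [p0 pU pP] [g0 gU _] [t e].
have /pP[] : dvdr p (t * g) by exists 1; rewrite mul1r.
  move=> [s ts]; case/negP: gU; apply/unitrP; exists s.
  suff sg : s * g = 1 by rewrite [g * s]mulrC sg.
  by apply: (mulIf p0); rewrite mul1r {2}e ts; ring.
by [].
Qed.

(** A relation rather than a function: existence of the valuation relies on factoriality, its
    uniqueness does not. *)
Definition has_val p k a := exists2 b, a = p ^+ k * b & ~ dvdr p b.

Lemma has_val_ex p a : is_ufd R -> prime_elt p -> a != 0 -> exists k, has_val p k a.
Proof.
move=> fR pp /fR[l]; elim: l a => [|l IH] a la;
  have [pa|npa] := pselect (dvdr p a); try by (exists 0%N, a; rewrite ?expr0 ?mul1r).
  by have [k' [c' []]] := pfact_dvd la pp pa.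
have [k' [c' [[<-] ea lc']]] := pfact_dvd la pp pa.
by have [k [b eb nb]] := IH _ lc'; exists k.+1, b => //; rewrite ea eb exprS mulrA.
Qed.

Lemma has_val_uniq p k l a : p != 0 -> has_val p k a -> has_val p l a -> k = l.
Proof.
move=> p0; elim: k l a => [|k IH] [|l] a //.
- move=> [b ->]; rewrite expr0 mul1r => nb [c eb _]; case: nb.
  by rewrite eb exprS -mulrA mulrC; exists (p ^+ l * c).
- move=> [b -> _] [c]; rewrite expr0 mul1r => <- []; exists (p ^+ k * b).
  by rewrite exprS -mulrA mulrC.
move=> [b -> nb] [c e nc]; congr _.+1; apply: (IH _ (p ^+ k * b)); first by exists b.
by exists c => //; apply: (mulfI p0); rewrite !mulrA -!exprS.
Qed.

Lemma has_valM p k l a b : prime_elt p -> has_val p k a -> has_val p l b ->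
  has_val p (k + l) (a * b).
Proof.
move=> [_ _ pP] [a' -> na] [b' -> nb]; exists (a' * b'); first by rewrite exprD; ring.
by case/pP.
Qed.

Lemma has_val_dvd p k a : has_val p k.+1 a -> dvdr p a.
Proof. by move=> [b -> _]; rewrite exprS -mulrA; apply/dvdr_mulr; exists 1; rewrite mul1r. Qed.

Lemma has_val1 p : prime_elt p -> has_val p 1 p.
Proof.
move=> [_ pU _]; exists 1; rewrite ?mulr1 ?expr1 // => p1.
by rewrite (dvdr_unit _ p1) ?unitr1 in pU.
Qed.

Lemma has_val1_unit p : prime_elt p -> has_val p 0 1.
Proof.
move=> [_ pU _]; exists 1; rewrite ?mulr1 ?expr0 // => p1.
by rewrite (dvdr_unit _ p1) ?unitr1 in pU.
Qed.

End Divisibility.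

(** * Values of a form over an integral domain and parity of valuations *)

Section Form.
Variables (R : idomainType) (d : nat).
Implicit Types (Q : 'M[R]_d) (v w : 'rV[R]_d) (a b p : R).

Definition qf Q v : R := (v *m Q *m v^T) 0 0.

Definition qf_aniso Q := forall v, qf Q v = 0 -> v = 0.

Definition dvdv p v := exists w, v = p *: w.

Definition qf_iso_mod Q p := exists2 v, ~ dvdv p v & dvdr p (qf Q v).

(* An element of R lies in D_F(Q)^k for some k <= m, up to squares, where F is
   the fraction field of R; the denominators are gathered in h. *)
Definition value_prod Q m a := a != 0 /\ exists s : seq 'rV[R]_d,
  (size s <= m)%N /\ exists h, exists2 h', (h != 0) && (h' != 0) &
  a * h ^+ 2 = h' ^+ 2 * \prod_(v <- s) qf Q v.

Definition odd_iso Q a := forall p k, prime_elt p -> has_val p k a -> odd k -> qf_iso_mod Q p.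

Lemma dvdvP p v : dvdv p v <-> forall i, dvdr p (v 0 i).
Proof.
split=> [[w ->] i|/fin_all_exists[u uP]]; first by rewrite mxE mulrC; exists (w 0 i).
by exists (\row_i u i); apply/rowP => i; rewrite !mxE mulrC.
Qed.

Lemma qfZ Q a v : qf Q (a *: v) = a ^+ 2 * qf Q v.
Proof. by rewrite /qf linearZ /= -!scalemxAl -scalemxAr scalerA mxE expr2. Qed.

Lemma qf_sum Q v : qf Q v = \sum_i \sum_j v 0 i * Q i j * v 0 j.
Proof.
rewrite /qf mxE [RHS]exchange_big; apply: eq_bigr => j _.
by rewrite !mxE mulr_suml.
Qed.

Lemma dvdr_qfD Q p v w : dvdr p (qf Q (v + p *: w)) <-> dvdr p (qf Q v).
Proof.
set t := (v *m Q *m w^T) 0 0 + (w *m Q *m v^T) 0 0 + p * (w *m Q *m w^T) 0 0.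
have e : qf Q (v + p *: w) = t * p + qf Q v.
  rewrite /qf /t linearD linearZ /= !mulmxDl !mulmxDr -!scalemxAl -!scalemxAr.
  by rewrite !mxE; ring.
have pt : dvdr p (t * p) by exists t.
by rewrite e; split; [apply: dvdr_addr|apply: dvdr_add].
Qed.

Lemma value_prodW Q m l a : (m <= l)%N -> value_prod Q m a -> value_prod Q l a.
Proof. by move=> ml [a0 [s [sm H]]]; split=> //; exists s; split=> //; apply: leq_trans ml. Qed.

Lemma value_prodM Q m l a b :
  value_prod Q m a -> value_prod Q l b -> value_prod Q (m + l) (a * b).
Proof.
move=> [a0 [s [sm [h [h' /andP[h0 h'0] e]]]]] [b0 [t [tl [g [g' /andP[g0 g'0] f]]]]].
split; first by rewrite mulf_neq0.
exists (s ++ t); split; first by rewrite size_cat leq_add.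
exists (h * g), (h' * g'); first by rewrite !mulf_neq0.
by rewrite big_cat /= exprMn mulrACA e f; ring.
Qed.

Lemma value_prodMsq Q m a b : b != 0 -> value_prod Q m (a * b ^+ 2) <-> value_prod Q m a.
Proof.
move=> b0; split=> -[a0 [s [sm [h [h' /andP[h0 h'0] e]]]]].
  split; first by apply: contraNneq a0 => ->; rewrite mul0r.
  exists s; split=> //; exists (b * h), h'; first by rewrite !mulf_neq0.
  by rewrite -e; ring.
split; first by rewrite mulf_neq0 ?expf_neq0.
exists s; split=> //; exists h, (b * h'); first by rewrite h0 mulf_neq0.
by rewrite [LHS]mulrAC e; ring.
Qed.

Lemma value_prod1 Q : value_prod Q 0 1.
Proof.
split; first exact: oner_neq0.
by exists [::]; split=> //; exists 1, 1; rewrite ?oner_neq0 // big_nil mulrC.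
Qed.

Lemma value_prod_qf Q v : qf Q v != 0 -> value_prod Q 1 (qf Q v).
Proof.
move=> v0; split=> //; exists [:: v]; split=> //; exists 1, 1; rewrite ?oner_neq0 //.
by rewrite big_seq1; ring.
Qed.

(* If p does not divide v then p does not divide qf Q v; dividing v by p
   lowers the valuation of qf Q v by 2. *)
Lemma qf_even_val Q p v k : prime_elt p -> ~ qf_iso_mod Q p ->
  has_val p k (qf Q v) -> ~~ odd k.
Proof.
move=> pp ni; have [p0 _ _] := pp; have [l] := ubnP k.
elim: l k v => // l IH [|k] v //; rewrite ltnS => kl vk.
have [[w vw]|nv] := pselect (dvdv p v); last first.
  by case: ni; exists v => //; apply: has_val_dvd vk.
move: vk; rewrite vw qfZ => -[b e nb]; case: k kl e => [|k] kl e.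
  case: nb; exists (qf Q w); apply: (mulfI p0).
  by rewrite expr1 in e; rewrite -e; ring.
rewrite /= negbK; apply: (IH _ w); first exact: ltnW.
exists b => //; apply: (mulfI (expf_neq0 2 p0)).
by rewrite e !exprS expr0; ring.
Qed.

Hypothesis fR : is_ufd R.

Lemma value_prod_odd_iso Q m a : value_prod Q m a -> odd_iso Q a.
Proof.
move=> [a0 [s [_ [h [h' /andP[h0 h'0] e]]]]] p k pp ak ok; apply: contrapT => ni.
have [p0 _ _] := pp.
have [l hl] := has_val_ex fR pp h0; have [l' hl'] := has_val_ex fR pp h'0.
have : a * h ^+ 2 != 0 by rewrite mulf_neq0 ?expf_neq0.
rewrite e mulf_eq0 negb_or => /andP[_ s0].
have [r rP ev] : exists2 r, has_val p r (\prod_(v <- s) qf Q v) & ~~ odd r.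
  elim: s s0 {e} => [|v s IH]; first by exists 0%N; rewrite ?big_nil //; apply: has_val1_unit.
  rewrite big_cons mulf_eq0 negb_or => /andP[v0 /IH[r rP ev]].
  have [t tP] := has_val_ex fR pp v0; exists (t + r)%N; first exact: has_valM.
  by rewrite oddD (negbTE ev) (negbTE (qf_even_val pp ni tP)).
(* The valuations of the two sides of [e] agree. Squares contribute evenly and [r] is even, so [k]
   cannot be odd. *)
have H1 : has_val p (k + (l + l)) (a * h ^+ 2) by rewrite expr2; do !apply: has_valM.
have H2 : has_val p (l' + l' + r) (a * h ^+ 2).
  by rewrite e expr2; do !apply: has_valM.
have /(congr1 odd) := has_val_uniq p0 H1 H2.
by rewrite !oddD !addbb ok (negbTE ev).
Qed.

(** At a prime where [b] has odd valuation, exactly one of [a] and [a * b] has odd valuation. *)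
Lemma odd_isoMr Q a b : a != 0 -> odd_iso Q a -> odd_iso Q (a * b) -> odd_iso Q b.
Proof.
move=> a0 ia iab p k pp bk ok; have [l al] := has_val_ex fR pp a0.
have [ol|el] := boolP (odd l); first exact: ia al ol.
by apply: (iab p (l + k)%N) => //; [apply: has_valM|rewrite oddD (negbTE el) ok].
Qed.

Lemma odd_iso_sq Q a : a != 0 -> odd_iso Q (a * a).
Proof.
move=> a0 p k pp ak; have [l al] := has_val_ex fR pp a0; have [p0 _ _] := pp.
by rewrite (has_val_uniq p0 ak (has_valM pp al al)) oddD addbb.
Qed.

Lemma qf_iso_mod_assoc Q p g : prime_elt p -> prime_elt g -> dvdr g p ->
  qf_iso_mod Q p -> qf_iso_mod Q g.
Proof.
move=> pp gp gdp [v nv pv]; exists v; last exact: dvdr_trans gdp pv.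
move/dvdvP => gv; apply: nv; apply/dvdvP => i.
by apply: dvdr_trans (gv i); apply: dvdr_prime_sym.
Qed.

Lemma odd_iso_prime Q p : prime_elt p -> qf_iso_mod Q p -> odd_iso Q p.
Proof.
move=> pp ip g [|k] // gp pk _.
exact: qf_iso_mod_assoc pp gp (has_val_dvd pk) ip.
Qed.

End Form.

(** * Transport along ring morphisms and isomorphisms *)

Section FormMorphism.
Variables (R S : idomainType) (d : nat) (g : {rmorphism R -> S}) (Q : 'M[R]_d).

Lemma qf_map v : qf (map_mx g Q) (map_mx g v) = g (qf Q v).
Proof. by rewrite /qf map_trmx -!map_mxM mxE. Qed.

Hypothesis g_inj : injective g.

Lemma value_prod_map m a : value_prod Q m a -> value_prod (map_mx g Q) m (g a).
Proof.
have g0 b : b != 0 -> g b != 0 by rewrite -(rmorph0 g) (inj_eq g_inj).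
move=> [a0 [s [sm [h [h' /andP[h0 h'0] e]]]]]; split; first exact: g0.
exists [seq map_mx g v | v <- s]; rewrite size_map; split=> //.
exists (g h), (g h'); first by rewrite !g0.
rewrite big_map -!rmorphXn -rmorphM e rmorphM rmorph_prod; congr (_ * _).
by apply: eq_bigr => v _; rewrite qf_map.
Qed.

Lemma qf_aniso_map : qf_aniso (map_mx g Q) -> qf_aniso Q.
Proof.
move=> an v v0; have /an : qf (map_mx g Q) (map_mx g v) = 0 by rewrite qf_map v0 rmorph0.
move=> gv0; apply/rowP => i; apply: g_inj.
by move/rowP: gv0 => /(_ i); rewrite !mxE rmorph0.
Qed.

End FormMorphism.

Section FormIsomorphism.
Variables (R S : idomainType) (d : nat) (g : {rmorphism R -> S}) (h : {rmorphism S -> R}).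
Hypotheses (gK : cancel g h) (hK : cancel h g).

Lemma odd_iso_iso (Q : 'M[R]_d) a : odd_iso Q a -> odd_iso (map_mx g Q) (g a).
Proof.
have hd b c : dvdr b c -> dvdr (h b) (h c).
  by move=> [q ->]; exists (h q); rewrite rmorphM.
have gd b c : dvdr b c -> dvdr (g b) (g c).
  by move=> [q ->]; exists (g q); rewrite rmorphM.
move=> ia p k pp [b e nb] ok.
have [||//|v nv pv] := ia (h p) k.
- exact: prime_iso gK hK _ pp.
- exists (h b); first by rewrite -rmorphXn -rmorphM -e gK.
  by move/gd; rewrite !hK.
exists (map_mx g v); last by rewrite qf_map -[p]hK; apply: gd.
move/dvdvP => H; apply: nv; apply/dvdvP => i.
by have := H i; rewrite mxE => /hd; rewrite gK.
Qed.

End FormIsomorphism.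

(** * Adjoining one variable: descent on the degree over R[X] *)

Section FormPoly.
Variables (R : idomainType) (d : nat) (Q : 'M[R]_d).
Hypotheses (fR : is_ufd R) (Qan : qf_aniso Q).
Notation QX := (map_mx polyC Q).
Implicit Types (f p q g : {poly R}) (v w r u : 'rV[{poly R}]_d).

Definition coefv e v : 'rV[R]_d := map_mx (fun p => p`_e) v.

Definition vsize v := \max_i size (v 0%R i).

Lemma coefM_top f g e : (size f <= e.+1)%N -> (size g <= e.+1)%N ->
  (f * g)`_(e + e) = f`_e * g`_e.
Proof.
move=> fe ge; rewrite coefM.
have le : (e < (e + e).+1)%N by rewrite ltnS leq_addr.
rewrite (bigD1 (Ordinal le)) //= addnK big1 ?addr0 // => j.
rewrite -val_eqE /= neq_ltn => /orP[] je.
  rewrite [g`__]nth_default ?mulr0 //; apply: leq_trans ge _.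
  by rewrite -addnBA ?(ltnW je) // -addn1 leq_add2l subn_gt0.
by rewrite nth_default ?mul0r //; apply: leq_trans fe je.
Qed.

Lemma qf_top v e : (forall i, size (v 0%R i) <= e.+1)%N ->
  (size (qf QX v) <= (e + e).+1)%N /\ (qf QX v)`_(e + e) = qf Q (coefv e v).
Proof.
move=> ve; have se i j : (size (v 0 i * (Q i j)%:P)%R <= e.+1)%N.
  by rewrite mulrC mul_polyC; apply: leq_trans (size_scale_leq _ _) _.
rewrite !qf_sum; split.
  apply: leq_trans (size_sum _ _ _) _; apply/bigmax_leqP => i _.
  apply: leq_trans (size_sum _ _ _) _; apply/bigmax_leqP => j _.
  rewrite !mxE; apply: leq_trans (size_polyMleq _ _) _.
  by rewrite -subn1 leq_subLR; apply: leq_trans (leq_add (se i j) (ve j)) _; lia.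
rewrite coef_sum; apply: eq_bigr => i _; rewrite coef_sum; apply: eq_bigr => j _.
by rewrite !mxE coefM_top // coefMC.
Qed.

(** Anisotropy of [Q] prevents the top coefficient from cancelling: it is the value of [Q] at the
    nonzero vector of coefficients of degree [e]. *)
Lemma qf_lead v : v != 0 -> exists e, [/\ vsize v = e.+1,
  size (qf QX v) = (e + e).+1 & lead_coef (qf QX v) = qf Q (coefv e v)].
Proof.
move=> v0; have [i vi] : exists i, v 0%R i != 0.
  by apply/existsP; apply: contraNT v0 => /existsPn H; apply/eqP/rowP => i;
     rewrite mxE; apply/eqP; rewrite -[_ == _]negbK H.
have [j vj] : {j | vsize v = size (v 0%R j)}.
  by apply: eq_bigmax; rewrite (cardD1 i).
have vgt : (0 < vsize v)%N.
  by apply: leq_trans (leq_bigmax i); rewrite size_poly_gt0.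
exists (vsize v).-1; have eP := prednK vgt; set e := (vsize v).-1 in eP *.
have ve k : (size (v 0%R k) <= e.+1)%N by rewrite eP; apply: (leq_bigmax k).
have [sq cq] := qf_top ve.
have nz : qf Q (coefv e v) != 0.
  apply: contraTneq vgt => /Qan /rowP /(_ j); rewrite !mxE.
  have -> : e = (size (v 0%R j)).-1 by rewrite /e vj.
  by move/eqP; rewrite -lead_coefE lead_coef_eq0 -size_poly_eq0 -vj => /eqP ->.
have sE : size (qf QX v) = (e + e).+1.
  apply/eqP; rewrite eqn_leq sq /= ltnNge; apply/negP => le.
  by move/eqP: nz; apply; rewrite -cq nth_default.
by split=> //; rewrite lead_coefE sE.
Qed.

Lemma qf_aniso_poly : qf_aniso QX.
Proof.
move=> v qv; apply/eqP/negPn/negP => /qf_lead[e [_]].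
by rewrite qv size_poly0.
Qed.

(** The constant term of [v] is isotropic modulo [c], unless [c] divides it. In that case [v] is
    congruent to ['X *: w] modulo [c], and [w] is a shorter vector with the same properties, since
    [c] does not divide ['X ^+ 2]. *)
Lemma iso_mod_polyC c : prime_elt c -> qf_iso_mod QX c%:P -> qf_iso_mod Q c.
Proof.
move=> cp; have cpX := prime_polyC cp.
have dC0 f : dvdr c%:P f -> dvdr c f`_0 by move/dvdrC.
move=> [v]; have [m] := ubnP (vsize v); elim: m v => // m IH v; rewrite ltnS => vm nv cv.
have [c0|nc0] := pselect (dvdv c (coefv 0 v)); last first.
  exists (coefv 0 v) => //; move/dC0: cv; rewrite !qf_sum coef_sum.
  congr dvdr; apply: eq_bigr => i _; rewrite coef_sum; apply: eq_bigr => j _.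
  by rewrite !mxE !coef0M coefC.
have [w0 w0E] := c0.
pose w : 'rV[{poly R}]_d := map_mx (drop_poly 1) v.
have vE : v = 'X *: w + c%:P *: map_mx polyC w0.
  apply/rowP => i; rewrite !mxE -polyCM; move/rowP/(_ i): w0E; rewrite !mxE => <-.
  apply/polyP => -[|k]; rewrite coefD coefXM coefC /=; first by rewrite add0r.
  by rewrite coef_drop_poly addn1 addr0.
have v0 : v != 0.
  by apply/eqP => v0; apply: nv; rewrite v0; exists 0; rewrite scaler0.
(* This puts [vsize v] in successor form, so that dropping the constant terms strictly shortens
   [v]. *)
have [e [ve _ _]] := qf_lead v0.
apply: (IH w).
- rewrite -ltnS; apply: leq_trans (_ : (vsize v).+1 <= _)%N; last by [].
  rewrite ltnS ve ltnS; apply/bigmax_leqP => i _; rewrite mxE size_drop_poly.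
  by rewrite leq_subLR add1n -ve; apply: (leq_bigmax i).
- move=> /dvdvP cw; apply: nv; apply/dvdvP => i; rewrite vE !mxE.
  apply: dvdr_add; first by have := cw i; rewrite !mxE; apply: dvdr_mull.
  by apply: dvdr_mulr; exists 1; rewrite mul1r.
move: cv; rewrite vE dvdr_qfD qfZ; apply: dvdr_primeM => //.
by move/dvdrC => /(_ 2%N); rewrite coefXn eqxx => /(dvdr_unit (unitr1 _)); case: cp => _ /negP.
Qed.

Lemma odd_iso_polyC c : odd_iso QX c%:P -> odd_iso Q c.
Proof.
move=> ic p k pp [b e nb] ok; apply: iso_mod_polyC => //; apply: (ic _ k) => //.
  exact: prime_polyC.
exists b%:P; first by rewrite e polyCM rmorphXn.
by move/dvdrC => /(_ 0%N); rewrite coefC.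
Qed.

Lemma pos_prime_factor f : (1 < size f)%N ->
  exists p q, [/\ prime_elt p, (1 < size p)%N & f = p * q].
Proof.
move=> f1; have /(ufd_poly fR)[k kf] : f != 0 by rewrite -size_poly_gt0 ltnW.
elim: kf f1 => {k f} [u uU|k p a pp _ IH] f1.
  by move: uU; rewrite poly_unitE gtn_eqF.
have [p1|p1] := ltnP 1 (size p); first by exists p, a.
have [p0 _ _] := pp; have sp : size p = 1%N.
  by apply/eqP; rewrite eqn_leq p1 size_poly_gt0.
have a0 : a != 0 by apply: contraTneq f1 => ->; rewrite mulr0 size_poly0.
move: f1; rewrite size_mul // sp add1n /= => /IH[g [q [gp g1 ->]]].
by exists g, (p * q); rewrite mulrCA.
Qed.

Lemma dvdr_leq_size p f : f != 0 -> dvdr p f -> (size p <= size f)%N.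
Proof.
move=> f0 [q e]; move: f0; rewrite e mulf_eq0 negb_or => /andP[q0 p0].
by rewrite size_mul //; move: q0; rewrite -size_poly_gt0; lia.
Qed.

Lemma vector_pseudo_division p v : p != 0 -> exists c w r,
  [/\ c != 0, c%:P *: v = p *: w + r & forall i, (size (r 0%R i) < size p)%N].
Proof.
move=> p0; pose c i := lead_coef p ^+ scalp (v 0%R i) p.
have cnz i : c i != 0 by rewrite expf_neq0 // lead_coef_eq0.
(* Pseudo-division multiplies coordinate [i] by its own [c i]; the cofactor [c' i] completes it to a
   multiplier common to all coordinates. *)
pose c' i := \prod_(j | j != i) c j.
exists (\prod_i c i), (\row_i ((c' i)%:P * (v 0%R i %/ p))), (\row_i ((c' i)%:P * (v 0%R i %% p))).
split.
- by apply/prodf_neq0.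
- apply/rowP => i; rewrite !mxE (bigD1 i) //= -/(c' i) polyCM.
  have := Pdiv.Idomain.divp_eq (v 0%R i) p; rewrite -mul_polyC -/(c i) => e.
  by rewrite mulrAC e; ring.
move=> i; rewrite mxE mul_polyC; apply: leq_ltn_trans (size_scale_leq _ _) _.
exact: Pdiv.Idomain.ltn_modpN0.
Qed.

(** The pseudo-remainder [r] of [v] is nonzero, as otherwise [p] would divide [c%:P *: v], hence
    [v]. Primes of positive degree are then divided out of [r] one at a time. Constant primes may
    still divide the result, which is harmless: [value_prod_all_iso] asks for isotropy only at
    primes of positive degree. *)
Lemma small_isotropic_vector p : prime_elt p -> (1 < size p)%N -> qf_iso_mod QX p ->
  exists r, [/\ r != 0, (vsize r < size p)%N, dvdr p (qf QX r) &
    forall g, prime_elt g -> (1 < size g)%N -> ~ dvdv g r].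
Proof.
move=> pp p1 [v nv pv]; have [p0 _ _] := pp.
have [c [w [r [c0 e sr]]]] := vector_pseudo_division v p0.
have npC g b : (1 < size g)%N -> b != 0 -> ~ dvdr g b%:P.
  move=> g1 b0 /dvdr_leq_size; rewrite polyC_eq0 => /(_ b0).
  by rewrite size_polyC b0 leqNgt g1.
have r0 : r != 0.
  apply/eqP => r0; apply: nv; apply/dvdvP => i.
  apply: (dvdr_primeM (a := c%:P) pp); first exact: npC.
  by move/rowP/(_ i): e; rewrite r0 !mxE addr0 => ->; apply/dvdr_mulr; exists 1; rewrite mul1r.
have pr : dvdr p (qf QX r).
  have -> : r = c%:P *: v + p *: - w by rewrite e scalerN addrAC subrr add0r.
  by apply/dvdr_qfD; rewrite qfZ; apply: dvdr_mull.
have {}sr : (vsize r < size p)%N.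
  rewrite -[size p]prednK ?(ltnW p1) // ltnS; apply/bigmax_leqP => i _.
  by rewrite -ltnS prednK // ltnW.
have [m] := ubnP (vsize r); elim: m r r0 sr pr {e} => // m IH r r0 sr pr; rewrite ltnS => rm.
have [H|] := pselect (forall g, prime_elt g -> (1 < size g)%N -> ~ dvdv g r).
  by exists r.
move=> /existsNP[g /not_implyP[gp /not_implyP[g1 /contrapT[u ru]]]].
have [g0 _ _] := gp; have u0 : u != 0 by apply: contraNneq r0 => u0; rewrite ru u0 scaler0.
have [eu [ueu _ _]] := qf_lead u0; have [er [rer _ _]] := qf_lead r0.
have gr i : size (r 0%R i) = if u 0%R i == 0 then 0%N else (size g + size (u 0%R i)).-1.
  rewrite ru mxE; case: eqP => [->|/eqP ui]; first by rewrite mulr0 size_poly0.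
  by rewrite size_mul.
have ur : (vsize u < vsize r)%N.
  rewrite rer ltnS; apply/bigmax_leqP => i _; rewrite -ltnS -rer.
  have := leq_bigmax (F := fun i => size (r 0%R i)) i; rewrite -/(vsize r) gr rer.
  case: eqP => [->|_]; rewrite ?size_poly0 //.
  move: g1; case: (size g) => [|[|k]] // _; rewrite !addSn /= ltnS => ke.
  by rewrite ltnS; apply: leq_trans ke; apply: leq_addl.
(* A nonzero entry of [r] is a multiple of [g] and is shorter than [p]. Hence [p] does not divide
   [g ^+ 2], and it still divides the value at [u]. *)
have gsz : (size g < size p)%N.
  have /existsP[i ui] : [exists i, u 0%R i != 0].
    by apply: contraNT u0 => /existsPn H; apply/eqP/rowP => i;
       rewrite mxE; apply/eqP; rewrite -[_ == _]negbK H.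
  apply: leq_ltn_trans sr; apply: leq_trans (leq_bigmax i).
  by rewrite gr (negbTE ui); move: ui; rewrite -size_poly_gt0; lia.
apply: (IH u) => //.
- exact: ltn_trans ur sr.
- move: pr; rewrite ru qfZ; apply: dvdr_primeM => // pg.
  have /dvdr_leq_size : dvdr p g.
    by move: pg; rewrite expr2; case: pp => _ _ pP /pP[].
  by rewrite leqNgt gsz => /(_ g0).
exact: leq_trans ur rm.
Qed.


Definition deg f := (size f).-1.

Lemma degM f g : f != 0 -> g != 0 -> deg (f * g) = (deg f + deg g)%N.
Proof.
by move=> f0 g0; rewrite /deg size_mul //; move: f0 g0; rewrite -!size_poly_gt0; lia.
Qed.

Lemma value_prod_const f : f != 0 -> deg f = 0%N -> value_prod QX 0 (f * (lead_coef f)%:P).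
Proof.
move=> f0 df; have /size1_polyC e : (size f <= 1)%N by move: df; rewrite /deg; lia.
have c0 : f`_0 != 0 by apply: contraNneq f0 => c0; rewrite e c0.
move: (f`_0) e c0 => c -> c0; rewrite lead_coefC -expr2 -[_ ^+ 2]mul1r.
by apply/value_prodMsq; rewrite ?polyC_eq0 //; apply: value_prod1.
Qed.

Lemma value_prod_leadM m l f g : value_prod QX m (f * (lead_coef f)%:P) ->
  value_prod QX l (g * (lead_coef g)%:P) ->
  value_prod QX (m + l) (f * g * (lead_coef (f * g))%:P).
Proof. by move=> H1 H2; rewrite lead_coefM polyCM mulrACA; apply: value_prodM. Qed.

(* Writing qf r = p h with deg h <= deg p - 2, every prime factor of h is again
   isotropic, and the leading coefficient of qf r is itself a value of the form. *)
Lemma value_prod_all_iso f : f != 0 ->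
  (forall p, prime_elt p -> (1 < size p)%N -> dvdr p f -> qf_iso_mod QX p) ->
  value_prod QX (deg f) (f * (lead_coef f)%:P).
Proof.
have [m] := ubnP (deg f); elim: m f => // m IH f; rewrite ltnS => fm f0 fiso.
have [f1|f1] := leqP (size f) 1.
  have df : deg f = 0%N by rewrite /deg; lia.
  by rewrite df; apply: value_prod_const.
have [p [q [pp p1 fE]]] := pos_prime_factor f1.
have [p0 pU _] := pp; have q0 : q != 0 by apply: contraNneq f0 => q0; rewrite fE q0 mulr0.
have dp : (0 < deg p)%N by rewrite /deg; lia.
have df : deg f = (deg p + deg q)%N by rewrite fE degM.
have pf : dvdr p f by exists q; rewrite fE mulrC.
have [r [r0 rp [h hE] rprim]] := small_isotropic_vector pp p1 (fiso p pp p1 pf).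
have [e [re se le]] := qf_lead r0.
have qr0 : qf QX r != 0 by rewrite -size_poly_gt0 se.
have h0 : h != 0 by apply: contraNneq qr0 => h0; rewrite hE h0 mul0r.
(* The value at [r] has degree [e + e] with [e < deg p]. *)
have dh : (deg h + 2 <= deg p)%N.
  have : deg (qf QX r) = (deg h + deg p)%N by rewrite hE degM.
  by rewrite {1}/deg se; move: rp; rewrite re /deg; lia.
have vh : value_prod QX (deg h) (h * (lead_coef h)%:P).
  apply: IH => // [|g gp g1 gh]; first by lia.
  by exists r; [apply: rprim|rewrite hE; apply: dvdr_mulr].
have vp : value_prod QX (deg p) (p * (lead_coef p)%:P).
  (* Up to squares, [p] times its leading coefficient is the product of the same expressions for [h]
     and for [qf QX r]. The first takes [deg h] values and the second takes two, which fits in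
     [deg p] by [dh]. *)
  have hh0 : h * (lead_coef h)%:P != 0 by rewrite mulf_neq0 // polyC_eq0 lead_coef_eq0.
  apply/(value_prodMsq _ _ _ hh0); apply: (value_prodW dh).
  have -> : p * (lead_coef p)%:P * (h * (lead_coef h)%:P) ^+ 2 =
      h * (lead_coef h)%:P * (qf QX r * (lead_coef (qf QX r))%:P).
    by rewrite hE lead_coefM polyCM; ring.
  have lq0 : qf Q (coefv e r) != 0 by rewrite -le lead_coef_eq0.
  apply: value_prodM => //; apply: (value_prodM (m := 1) (l := 1)).
    exact: value_prod_qf.
  rewrite le -(qf_map polyC Q); apply: value_prod_qf.
  by rewrite qf_map polyC_eq0.
rewrite df fE; apply: value_prod_leadM => //; apply: IH => // [|g gp g1 gq].
  by lia.
by apply: fiso => //; rewrite fE; apply: dvdr_mull.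
Qed.

(** Prime factors [p] of positive degree are split off. If [p] divides [f] twice, the square [p * p]
    is absorbed. Otherwise [p] has valuation one in [f], so it is isotropic and [value_prod_all_iso]
    provides [deg p] values for it. *)
Lemma value_prod_odd_iso_lead f : f != 0 -> odd_iso QX f ->
  value_prod QX (deg f) (f * (lead_coef f)%:P).
Proof.
have fRX := ufd_poly fR.
have [m] := ubnP (deg f); elim: m f => // m IH f; rewrite ltnS => fm f0 fiso.
have [f1|f1] := leqP (size f) 1.
  have df : deg f = 0%N by rewrite /deg; lia.
  by rewrite df; apply: value_prod_const.
have [p [q [pp p1 fE]]] := pos_prime_factor f1.
have [p0 pU _] := pp; have q0 : q != 0 by apply: contraNneq f0 => q0; rewrite fE q0 mulr0.
have dp : (0 < deg p)%N by rewrite /deg; lia.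
have df : deg f = (deg p + deg q)%N by rewrite fE degM.
have [[q' qE]|npq] := pselect (dvdr p q).
  have q'0 : q' != 0 by apply: contraNneq q0 => q'0; rewrite qE q'0 mul0r.
  have fE' : f = p * p * q' by rewrite fE qE; ring.
  have dq : deg q = (deg q' + deg p)%N by rewrite qE degM.
  have : value_prod QX (deg q') (q' * (lead_coef q')%:P).
    apply: IH => //; first by lia.
    apply: (odd_isoMr fRX (a := p * p)); first by rewrite mulf_neq0.
      exact: odd_iso_sq.
    by rewrite -fE'.
  have lp0 : p * (lead_coef p)%:P != 0 by rewrite mulf_neq0 // polyC_eq0 lead_coef_eq0.
  move/(value_prodMsq _ _ _ lp0); rewrite fE' !lead_coefM !polyCM.
  have -> : p * p * q' * ((lead_coef p)%:P * (lead_coef p)%:P * (lead_coef q')%:P) =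
    q' * (lead_coef q')%:P * (p * (lead_coef p)%:P) ^+ 2 by ring.
  by rewrite -fE'; apply: value_prodW; lia.
have ip : qf_iso_mod QX p.
  by apply: (fiso p 1%N) => //; exists q; rewrite // expr1.
rewrite df fE; apply: value_prod_leadM.
  apply: value_prod_all_iso => // g gp g1 gdp; by apply: qf_iso_mod_assoc gdp ip.
apply: IH => //; first by lia.
apply: (odd_isoMr fRX p0); first exact: odd_iso_prime.
by rewrite -fE.
Qed.

(** Up to squares, [f] is [f * (lead_coef f)%:P] times [(lead_coef f)%:P]. The leading coefficient
    satisfies [odd_iso] because both [f] and the first factor do, the latter being a product of
    values. *)
Lemma value_prod_poly f m : f != 0 -> odd_iso QX f ->
  (odd_iso Q (lead_coef f) -> value_prod Q m (lead_coef f)) ->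
  value_prod QX (deg f + m) f.
Proof.
move=> f0 fiso IH; have vf := value_prod_odd_iso_lead f0 fiso.
have lc0 : (lead_coef f)%:P != 0 by rewrite polyC_eq0 lead_coef_eq0.
apply/(value_prodMsq _ _ _ lc0); rewrite expr2 mulrA; apply: value_prodM => //.
apply: (value_prod_map (g := polyC)); first exact: polyC_inj.
apply: IH; apply: odd_iso_polyC.
by apply: (odd_isoMr (ufd_poly fR) f0) => //; apply: value_prod_odd_iso vf; apply: ufd_poly.
Qed.
End FormPoly.

(** * Passing between a domain and its fraction field *)

Section Fractions.
Variables (A : idomainType) (d : nat) (Q : 'M[A]_d).
Notation F := {fraction A}.
Notation QF := (map_mx (@tofrac A) Q).

Lemma tofrac_inj : injective (@tofrac A).
Proof. by move=> a b /eqP; rewrite tofrac_eq => /eqP. Qed.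

Lemma fracP (x : F) : exists a b, b != 0 /\ x * tofrac b = tofrac a.
Proof.
elim/quotW: x => y; exists (frac y).1, (frac y).2; split; first exact: denom_ratioP.
unlock tofrac; rewrite -[LHS]FracField.pi_mul; apply/eqmodP => /=.
rewrite FracField.equivfE /FracField.mulf.
by rewrite !numden_Ratio ?mulf_neq0 ?oner_neq0 ?denom_ratioP //; apply/eqP; ring.
Qed.

Lemma frac_rowP (w : 'rV[F]_d) :
  exists c, exists2 v : 'rV[A]_d, c != 0 & tofrac c *: w = map_mx (@tofrac A) v.
Proof.
have /fin_all_exists[a /fin_all_exists[b ab]] i := fracP (w 0 i).
exists (\prod_i b i), (\row_i (a i * \prod_(j | j != i) b j)).
  by apply/prodf_neq0 => i _; case: (ab i).
apply/rowP => i; have [_ e] := ab i.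
by rewrite !mxE (bigD1 i) //= !tofracM -e; ring.
Qed.

Lemma value_prod_of_frac m (b : 'I_m -> F) a : a != 0 ->
  (forall i, exists w, qf QF w = b i) -> tofrac a = \prod_(i < m) b i ->
  value_prod Q m a.
Proof.
move=> a0 bw ab; split=> //.
have /fin_all_exists[c /fin_all_exists[v cv]] i :
    exists c v, c != 0 /\ b i * tofrac c ^+ 2 = tofrac (qf Q v).
  have [w <-] := bw i; have [c [v c0 e]] := frac_rowP w; exists c, v; split=> //.
  by rewrite -qf_map -e qfZ mulrC.
exists [seq v i | i <- enum 'I_m]; rewrite size_map size_enum_ord; split=> //.
exists (\prod_i c i), 1.
  by rewrite oner_neq0 andbT; apply/prodf_neq0 => i _; case: (cv i).
apply: tofrac_inj; rewrite expr1n mul1r big_map big_enum /= tofracM ab tofracXn !rmorph_prod /=.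
by rewrite -prodrXl -big_split; apply: eq_bigr => i _; case: (cv i).
Qed.

(** The square of [h' / h] is absorbed by scaling the first vector. An empty list has no vector to
    scale, whence the first alternative, where [a] is a square in [F]. *)
Lemma value_prod_to_frac m a : value_prod Q m a ->
  (exists h, exists2 h', (h != 0) && (h' != 0) & a * h ^+ 2 = h' ^+ 2) \/
  exists2 k, (k <= m)%N & exists2 b : 'I_k -> F,
    forall i, b i != 0 /\ (exists w, qf QF w = b i) & tofrac a = \prod_(i < k) b i.
Proof.
move=> [a0 [[|v s] [sm [h [h' hh e]]]]].
  by left; exists h, h' => //; rewrite e big_nil mulr1.
right; exists (size s).+1 => //.
pose w (i : 'I_(size s).+1) :=
  (if i == ord0 then tofrac h' / tofrac h else 1) *: map_mx (@tofrac A) (nth 0 (v :: s) i).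
have ab : tofrac a = \prod_i qf QF (w i).
  case/andP: hh => h0 h'0; have th0 : tofrac h ^+ 2 != 0 by rewrite expf_neq0 // tofrac_eq0.
  apply: (mulIf th0); rewrite -tofracXn -tofracM e big_cons tofracM tofracXn tofracM.
  rewrite big_ord_recl /w eqxx qfZ qf_map /= rmorph_prod (big_nth 0) big_mkord.
  rewrite (eq_bigr (fun i : 'I_(size s) => tofrac (qf Q s`_i))); last first.
    by move=> i _; rewrite scale1r qf_map.
  by rewrite expr_div_n -[X in _ = X * _]mulrA [RHS]mulrAC tofracXn divfK.
exists (fun i => qf QF (w i)) => // i; split; last by exists (w i).
apply/eqP => wi0; move: a0; rewrite -tofrac_eq0 ab (bigD1 i) //= wi0 mul0r.
by rewrite eqxx.
Qed.

End Fractions.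

(** * Unitary polynomials in several variables *)

Section MultivariateValues.
Variables (K : fieldType) (d : nat) (G : 'M[K]_d).
Hypothesis Gan : qf_aniso G.
Notation QM n := (map_mx (@mpolyC n K) G).
Notation widen n := (widen_ord (leqnSn n)).

Definition mnmtrunc n (m : 'X_{1..n.+1}) : 'X_{1..n} := [multinom m (widen n i) | i < n].

Definition mnmext n (m : 'X_{1..n}) k : 'X_{1..n.+1} := (mnmwiden m + U_(ord_max) *+ k)%MM.

Lemma mnmext_max n (m : 'X_{1..n}) k : mnmext m k ord_max = k.
Proof. by rewrite mnmDE mulmnE mnmwiden_ordmax mnm1E eqxx mul1n. Qed.

Lemma mnmext_widen n (m : 'X_{1..n}) k i : mnmext m k (widen n i) = m i.
Proof.
by rewrite mnmDE mulmnE mnmwiden_widen mnm1E -val_eqE /= gtn_eqF // mul0n addn0.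
Qed.

Lemma ord_widenP n (i : 'I_n.+1) : (exists j, i = widen n j) \/ i = ord_max.
Proof.
have [lti|gei] := ltnP i n.
  by left; exists (Ordinal lti); apply: val_inj.
by right; apply/val_inj/eqP; rewrite eqn_leq gei -ltnS ltn_ord.
Qed.

Lemma mnmextE n (m : 'X_{1..n.+1}) (m0 : 'X_{1..n}) k :
  (m == mnmext m0 k) = (mnmtrunc m == m0) && (m ord_max == k).
Proof.
apply/eqP/andP => [->|[/eqP <- /eqP <-]].
  rewrite mnmext_max; split=> //; apply/eqP/mnmP => i.
  by rewrite mnmE mnmext_widen.
apply/mnmP => i; have [[j ->]|->] := ord_widenP i.
  by rewrite mnmext_widen mnmE.
by rewrite mnmext_max.
Qed.

Lemma mcoeff_muni n (p : {mpoly K[n.+1]}) k (m : 'X_{1..n}) :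
  (muni p)`_k@_m = p@_(mnmext m k).
Proof.
rewrite {2}[p]mpolyE muniE coef_sum !raddf_sum /=; apply: eq_bigr => m' _.
rewrite coefZ coefXn mcoeffZ mcoeffX mnmextE -/(mnmtrunc m') [k == _]eq_sym.
case: (m' ord_max == k); rewrite ?andbT ?andbF ?mulr1 ?mulr0 ?mcoeff0 //.
by rewrite mcoeffZ mcoeffX.
Qed.

(* [m] is the leading exponent of [f], with coefficient 1, for the lexicographic
   order in which the last variable is the largest. *)
Definition colex_unitary n (f : {mpoly K[n]}) (m : 'X_{1..n}) := f@_m = 1 /\
  forall m', m' \in msupp f -> m' != m ->
  exists2 i : 'I_n, forall j : 'I_n, (i < j)%N -> m' j = m j & (m' i < m i)%N.

(** [muni] makes the last variable the main one, and the colexicographic order compares that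
    variable first. So [m] fixes the degree, and among monomials of this degree the comparison is
    that of truncated exponents. *)
Lemma colex_unitary_muni n (f : {mpoly K[n.+1]}) m : colex_unitary f m ->
  size (muni f) = (m ord_max).+1 /\ colex_unitary (lead_coef (muni f)) (mnmtrunc m).
Proof.
move=> [fm mP]; have mE : mnmext (mnmtrunc m) (m ord_max) = m.
  by apply/esym/eqP; rewrite mnmextE !eqxx.
have wmax (i : 'I_n) : (widen n i < @ord_max n)%N := ltn_ord i.
have sf : size (muni f) = (m ord_max).+1.
  apply/eqP; rewrite eqn_leq; apply/andP; split; last first.
    rewrite ltnNge; apply/negP => le.
    have := mcoeff_muni f (m ord_max) (mnmtrunc m); rewrite mE fm nth_default // mcoeff0.
    by move/esym/eqP; rewrite oner_eq0.
  apply/leq_sizeP => k km; apply/mpolyP => m0; rewrite mcoeff_muni mcoeff0.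
  apply/eqP; rewrite mcoeff_eq0; apply/negP => /mP[|i].
    by apply: contraTneq km => e; rewrite -e mnmext_max ltnn.
  have [[j ->]|->] := ord_widenP i.
    by move=> /(_ _ (wmax j)); rewrite mnmext_max => kE; rewrite kE ltnn in km.
  by rewrite mnmext_max ltnNge ltnW.
split=> //; rewrite lead_coefE sf; split; first by rewrite mcoeff_muni mE.
move=> m'; rewrite mcoeff_msupp mcoeff_muni -mcoeff_msupp => /mP H m'm.
case: H => [|i].
  by apply: contraNneq m'm => <-; apply/eqP/mnmP => i; rewrite mnmE mnmext_widen.
have [[j ->] H|->] := ord_widenP i; last by rewrite mnmext_max ltnn.
rewrite mnmext_widen => lt; exists j; last by rewrite mnmE.
by move=> l jl; rewrite mnmE -(H (widen n l)) ?mnmext_widen.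
Qed.

Lemma mdeg_trunc n (m : 'X_{1..n.+1}) : mdeg m = (m ord_max + mdeg (mnmtrunc m))%N.
Proof.
by rewrite !mdegE big_ord_recr /= addnC; congr (_ + _)%N; apply: eq_bigr => i _; rewrite mnmE.
Qed.

Lemma map_muni n : map_mx (@muni n K) (QM n.+1) = map_mx polyC (QM n).
Proof. by apply/matrixP => i j; rewrite !mxE muniC. Qed.

Lemma qf_aniso_mpoly n : qf_aniso (QM n).
Proof.
elim: n => [|n IH].
  move=> v qv; have vE : v = map_mx (@mpolyC 0 K) (map_mx (mcoeff 0%MM) v).
    by apply/rowP => i; rewrite !mxE; apply: nvar0_mpolyC_eq.
  move: qv; rewrite vE qf_map => /eqP; rewrite mpolyC_eq0 => /eqP /Gan ->.
  by apply/rowP => i; rewrite !mxE.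
apply: (@qf_aniso_map _ _ _ (@muni n K)); first exact: can_inj (@muniK K n).
by rewrite map_muni; apply: qf_aniso_poly.
Qed.

(** Each variable contributes its exponent in [m] to the number of values: the last one as the
    degree of [muni f], the others by induction on the leading coefficient. Without variables, a
    unitary [f] is [1], the empty product. *)
Lemma value_prod_colex n (f : {mpoly K[n]}) m : colex_unitary f m ->
  odd_iso (QM n) f -> value_prod (QM n) (mdeg m) f.
Proof.
elim: n f m => [|n IH] f m fm fiso.
  have -> : f = 1.
    have m0 : m = 0%MM by apply/mnmP => -[].
    by case: fm; rewrite m0 [f]nvar0_mpolyC_eq // mcoeffC eqxx mulr1 => ->.
  exact: value_prodW (leq0n _) (value_prod1 _).
have [sf lf] := colex_unitary_muni fm.
have QE : QM n.+1 = map_mx (@mmulX K n) (map_mx (@muni n K) (QM n.+1)).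
  by apply/matrixP => i j; rewrite !mxE muniK.
rewrite -[f]muniK QE; apply: value_prod_map; first exact: can_inj (@mmulXK K n).
rewrite map_muni mdeg_trunc.
have -> : m ord_max = deg (muni f) by rewrite /deg sf.
apply: value_prod_poly.
- exact: ufd_mpoly.
- exact: qf_aniso_mpoly.
- by rewrite -size_poly_gt0 sf.
- by rewrite -map_muni; apply: (odd_iso_iso (@muniK K n) (@mmulXK K n) fiso).
- exact: IH.
Qed.

(** Reversing the variables is an involution that exchanges the lexicographic and colexicographic
    orders, fixes the constant matrix [QM n] and preserves the total degree of a monomial. *)
Lemma value_prod_lex n (f : {mpoly K[n]}) : f@_(lexlead f) = 1 ->
  odd_iso (QM n) f -> value_prod (QM n) (mdeg (lexlead f)) f.
Proof.
move=> f1 fiso; pose s : 'S_n := perm (@rev_ord_inj n).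
pose sm (m : 'X_{1..n}) := [multinom m (s i) | i < n].
have smE m i : sm m i = m (rev_ord i) by rewrite mnmE permE.
have ss m : sm (sm m) = m by apply/mnmP => i; rewrite !smE rev_ordK.
have symE (p : {mpoly K[n]}) m : (msym s p)@_m = p@_(sm m) by apply: mcoeff_sym.
have msK : cancel (@msym n K s) (@msym n K s).
  by move=> p; apply/mpolyP => m; rewrite !symE ss.
have QE : map_mx (@msym n K s) (QM n) = QM n.
  by apply/matrixP => i j; rewrite !mxE -alg_mpolyC msymZ msym1.
have <- : mdeg (sm (lexlead f)) = mdeg (lexlead f) by apply: mdeg_mperm.
rewrite -[f in value_prod _ _ f]msK -QE.
apply: value_prod_map; first exact: can_inj msK.
apply: value_prod_colex; last by rewrite -QE; apply: (odd_iso_iso msK msK fiso).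
split; first by rewrite symE ss.
move=> m'; rewrite mcoeff_msupp symE -mcoeff_msupp => /lexlead_max H ne.
have [|i H1 H2] := H; first by apply: contraNneq ne => <-; rewrite ss.
exists (rev_ord i) => [j ij|]; last by move: H2; rewrite !smE rev_ordK.
rewrite smE -H1 ?smE ?rev_ordK //=.
by move: ij => /=; have := ltn_ord i; have := ltn_ord j; lia.
Qed.

End MultivariateValues.

(** * Isotropy over K(f) as isotropy modulo f *)

Section FunctionFieldIsotropy.
Variables (K : fieldType) (n : nat) (f : {mpoly K[n]}) (f_irr : irreducible_elt f).

Lemma coord_pi_eq0 p : coord_pi f_irr p = 0 <-> dvdr f p.
Proof.
rewrite -(rmorph0 (coord_pi f_irr)); split=> [/eqP|fp].
  by rewrite -Quotient.idealrBE subr0 => /principal_idealP.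
by apply/eqP; rewrite -Quotient.idealrBE subr0; apply/principal_idealP.
Qed.

(** From left to right, denominators are cleared and the coordinates lifted to polynomials; nonzero
    in the coordinate ring means not divisible by [f]. From right to left, the vector is reduced
    modulo [f]. *)
Lemma isotropic_iso_mod d (phi : quadform K d) :
  isotropic (base_change (function_field_const f_irr) phi) <->
  qf_iso_mod (map_mx (@mpolyC n K) (gram phi)) f.
Proof.
pose Qc := map_mx (coord_pi f_irr) (map_mx (@mpolyC n K) (gram phi)).
have QE : gram (base_change (function_field_const f_irr) phi) =
    map_mx (@tofrac (coord_ring f_irr)) Qc.
  by apply/matrixP => i j; rewrite !mxE.
have qE w : qeval (base_change (function_field_const f_irr) phi) w =
    qf (map_mx (@tofrac (coord_ring f_irr)) Qc) w by rewrite /qeval QE.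
split=> [[w w0]|[v nv fv]].
  rewrite qE => qw; have [c [u c0 cu]] := frac_rowP w.
  have qu : qf Qc u = 0.
    apply: (@tofrac_inj (coord_ring f_irr)).
    by rewrite -qf_map -cu qfZ qw mulr0 tofrac0.
  pose v := map_mx (fun x : coord_ring f_irr => repr x : {mpoly K[n]}) u.
  have uv : u = map_mx (coord_pi f_irr) v.
    by apply/rowP => i; rewrite !mxE /coord_pi reprK.
  exists v; last by apply/coord_pi_eq0; rewrite -qf_map -uv.
  move/dvdvP => fv; case/eqP: w0; apply: (scalerI (a := tofrac c)).
    by rewrite tofrac_eq0.
  rewrite cu scaler0; apply/rowP => i; rewrite !mxE.
  by rewrite uv mxE; have /coord_pi_eq0 -> := fv i; rewrite tofrac0.
exists (map_mx (@tofrac (coord_ring f_irr)) (map_mx (coord_pi f_irr) v)).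
  apply/eqP => /rowP v0; apply: nv; apply/dvdvP => i; apply/coord_pi_eq0.
  by apply/eqP; rewrite -tofrac_eq0; have := v0 i; rewrite !mxE => ->.
have qv : qf Qc (map_mx (coord_pi f_irr) v) = 0.
  by rewrite qf_map; apply/coord_pi_eq0.
by rewrite qE qf_map qv rmorph0.
Qed.

End FunctionFieldIsotropy.

Theorem theorem3p16 (K : fieldType) (n : nat)
    (charK : 2%N \notin [pchar K])
    (phi : quadform K n)
    (phi_aniso : anisotropic phi)
    (phi_one : values phi 1)
    (f : {mpoly K[n]})
    (f_irr : irreducible_elt f)
    (f_vars : all_variables_appear f)
    (f_unitary : f@_(lexlead f) = 1) :
  (exists2 m : nat, (m <= mdeg (lexlead f))%N &
     value_products (base_change (rational_functions_const K n) phi) m (tofrac f))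
  <-> isotropic (base_change (function_field_const f_irr) phi).
Proof.
have ufdK := @ufd_mpoly K n.
have fp := irreducible_prime ufdK f_irr; have [f0 fU _] := fp.
pose Q := map_mx (@mpolyC n K) (gram phi).
have QE : gram (base_change (rational_functions_const K n) phi) =
    map_mx (@tofrac {mpoly K[n]}) Q by apply/matrixP => i j; rewrite !mxE.
have qE w : qeval (base_change (rational_functions_const K n) phi) w =
    qf (map_mx (@tofrac {mpoly K[n]}) Q) w by rewrite /qeval QE.
have phi_qan : qf_aniso (gram phi).
  move=> v qv; apply/eqP/negPn/negP => v0; apply: phi_aniso; by exists v.
rewrite isotropic_iso_mod; split=> [[m _ [b bv fb]]|fiso].
  have vf : value_prod Q m f.
    apply: (value_prod_of_frac (b := b)) => // i.
    by have [_ [w wb]] := bv i; exists w; rewrite -qE.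
  (* The prime considered is [f] itself, at which [f] has valuation one. *)
  exact: (value_prod_odd_iso ufdK vf fp (has_val1 fp)).
have vf := value_prod_lex phi_qan f_unitary (odd_iso_prime fp fiso).
have [[h [h' /andP[h0 h'0] e]]|[k km [b bv fb]]] := value_prod_to_frac vf.
  (* Here [f] would be a square in K(X), but the valuation at [f] is odd on the left of [e] and even
     on the right. *)
  have [l hl] := has_val_ex ufdK fp h0; have [l' hl'] := has_val_ex ufdK fp h'0.
  have H1 := has_valM fp (has_val1 fp) (has_valM fp hl hl).
  have := has_valM fp hl' hl'; rewrite -expr2 -e expr2 => /(has_val_uniq f0 H1).
  by move/(congr1 odd); rewrite !oddD !addbb.
exists k => //; exists b => // i; have [bi [w wb]] := bv i.
by split=> //; exists w; rewrite qE.
Qed.
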